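(* Let $\{(x^k,z^k,y^k)\}$ be a sequence generated by the Algorithm with $\varepsilon_k\to0$. Assume that $$\forall k\in\mathbb{N},\ \forall x\in\mathbb{R}^n:\quad \mathcal L_{\mu_k}(x^k,\hat y^k)\le\mathcal L_{\mu_k}(x,\hat y^k)+\varepsilon_k,$$ that the feasible set of (P) is nonempty, and that $\operatorname{dom} g$ is closed. Then $\limsup_{k\to\infty}(f(x^k)+g(z^k))\le\varphi(x)$ holds for all feasible $x\in\mathbb{R}^n$. Moreover, every accumulation point $\bar x\in\mathbb{R}^n$ of $\{x^k\}$ is globally optimal for (P). For any index set $K\subseteq\mathbb{N}$ such that $x^k\to_K\bar x$, it is also $z^k\to_K c(\bar x)$ and $f(x^k)+g(z^k)\to_K\varphi(\bar x)$.
   Context: Setting. $f:\mathbb{R}^n\to\mathbb{R}$ and $c:\mathbb{R}^n\to\mathbb{R}^m$ are twice continuously differentiable; $g:\mathbb{R}^m\to\mathbb{R}\cup\{\infty\}$ is proper, lower semicontinuous and prox-bounded, i.e. $g+\|\cdot\|^2/(2\mu)$ is bounded below for some $\mu>0$; $\mu_g\in(0,\infty]$ denotes the supremum of all such $\mu$. Problem (P) is to minimize $\varphi(x):=f(x)+g(c(x))$ over $x\in\mathbb{R}^n$, and $\inf\varphi\in\mathbb{R}$. No convexity is assumed. $\operatorname{dom} g:=\{z:g(z)<\infty\}$; $x$ is feasible for (P) if $c(x)\in\operatorname{dom} g$. Norms are Euclidean. Augmented Lagrangian: for $\mu>0$, $\mathcal L_\mu(x,y):=f(x)+g^\mu(c(x)+\mu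 y)-\frac\mu2\|y\|^2$, where $g^\mu(w):=\inf_{z}\{g(z)+\frac1{2\mu}\|z-w\|^2\}$ is the Moreau envelope. Proximal mapping: $\operatorname{prox}_{\mu g}(w):=\arg\min_{z}\{g(z)+\frac1{2\mu}\|z-w\|^2\}$ (set-valued). Algorithm (safeguarded implicit augmented Lagrangian method). Data: $\mu_0\in(0,\mu_g)$, $\theta\in(0,1)$, $\kappa\in(0,1)$, a nonempty bounded set $Y\subseteq\mathbb{R}^m$. For $k=0,1,2,\dots$: 1. select $\hat y^k\in Y$ and $\varepsilon_k\ge0$; 2. compute $(x^k,z^k)$ with $z^k\in\operatorname{prox}_{\mu_k g}(c(x^k)+\mu_k\hat y^k)$ and $\|\nabla f(x^k)+c'(x^k)^\top(\hat y^k+\mu_k^{-1}[c(x^k)-z^k])\|\le\varepsilon_k$; 3. set $y^k:=\hat y^k+\mu_k^{-1}[c(x^k)-z^k]$ and $V_k:=\|c(x^k)-z^k\|$; 4. if $k=0$ or $V_k\le\theta V_{k-1}$ set $\mu_{k+1}:=\mu_k$, otherwise $\mu_{k+1}:=\kappa\mu_k$. The algorithm is assumed to be well defined and to generate infinite sequences. $\to_K$ denotes convergence along the (infinite) index set $K$. *)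

(* Defs.v *)
From HB Require Import structures.
From mathcomp Require Import all_boot all_order all_algebra.
From mathcomp Require Import all_classical all_reals all_analysis.

Set Implicit Arguments.
Unset Strict Implicit.
Unset Printing Implicit Defensive.

Import Order.TTheory GRing.Theory Num.Theory.
Import numFieldNormedType.Exports.

Local Open Scope classical_set_scope.
Local Open Scope ring_scope.

(* The library norm `|v| on 'rV[R]_n is the sup norm.  It induces the same
   topology (limits, closed sets, differentials) and the same bounded sets as
   the Euclidean norm, which is used wherever a norm occurs in a formula. *)
Definition enorm (R : realType) (n : nat) (v : 'rV[R]_n) : R :=
  Num.sqrt (\sum_(i < n) v 0 i ^+ 2).

(* Because the domain has finite dimension, continuity (differentiability) of
   x |-> 'd h x as an operator-valued map is that of x |-> 'd h x v for all v. *)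
Definition C1 (R : realType) (n : nat) (W : normedModType R)
    (h : 'rV[R]_n -> W) : Prop :=
  (forall x, differentiable h x) /\
  forall v, continuous (fun x => 'd h x v).

Definition C2 (R : realType) (n : nat) (W : normedModType R)
    (h : 'rV[R]_n -> W) : Prop :=
  (forall x, differentiable h x) /\ forall v, C1 (fun x => 'd h x v).

Definition gradient (R : realType) (n : nat) (f : 'rV[R]_n -> R)
    (x : 'rV[R]_n) : 'rV[R]_n :=
  \row_(i < n) 'd f x (delta_mx 0 i).

(* The library Jacobian acts on row vectors: 'd c x v = v *m 'J c x.  Hence
   'J c x is the transpose of c'(x), and c'(x)^T u, written as a row, is
   u *m ('J c x)^T. *)
Definition adjoint_deriv (R : realType) (n m : nat)
    (c : 'rV[R]_n -> 'rV[R]_m) (x : 'rV[R]_n) (u : 'rV[R]_m) : 'rV[R]_n :=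
  u *m ('J c x)^T.

Section Problem.
Context {R : realType} {n m : nat}.
Variables (f : 'rV[R]_n -> R) (c : 'rV[R]_n -> 'rV[R]_m).
Variable g : 'rV[R]_m -> \bar R.

Definition dom : set 'rV[R]_m := [set z | (g z < +oo)%E].

Definition proper_ext : Prop := (forall z, g z != -oo%E) /\ dom !=set0.

Definition prox_params : set R :=
  [set mu | 0 < mu /\ exists b : R, forall z,
    (b%:E <= g z + (enorm z ^+ 2 / (2 * mu))%:E)%E].

Definition prox_bounded : Prop := prox_params !=set0.

Definition prox_threshold : \bar R := ereal_sup (EFin @` prox_params).

Definition prox_obj (mu : R) (w z : 'rV[R]_m) : \bar R :=
  (g z + (enorm (z - w) ^+ 2 / (2 * mu))%:E)%E.

Definition moreau_env (mu : R) (w : 'rV[R]_m) : \bar R :=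
  ereal_inf (range (prox_obj mu w)).

Definition prox (mu : R) (w : 'rV[R]_m) : set 'rV[R]_m :=
  [set z | forall z', (prox_obj mu w z <= prox_obj mu w z')%E].

Definition objective (x : 'rV[R]_n) : \bar R := ((f x)%:E + g (c x))%E.

Definition feasible (x : 'rV[R]_n) : Prop := dom (c x).

Definition globally_optimal (x : 'rV[R]_n) : Prop :=
  feasible x /\ forall x', (objective x <= objective x')%E.

Definition aug_lagrangian (mu : R) (x : 'rV[R]_n) (y : 'rV[R]_m) : \bar R :=
  ((f x)%:E + moreau_env mu (c x + mu *: y)
   - (mu / 2 * enorm y ^+ 2)%:E)%E.

Record ialm_sequence (mu0 theta kappa : R) (Y : set 'rV[R]_m)
    (eps mu : nat -> R) (yhat : nat -> 'rV[R]_m)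
    (x : nat -> 'rV[R]_n) (z y : nat -> 'rV[R]_m) (V : nat -> R) : Prop := {
  ialm_mu0 : mu 0%N = mu0;
  ialm_yhat : forall k, Y (yhat k);
  ialm_eps : forall k, 0 <= eps k;
  ialm_prox : forall k, prox (mu k) (c (x k) + mu k *: yhat k) (z k);
  ialm_stat : forall k,
    enorm (gradient f (x k)
           + adjoint_deriv c (x k)
               (yhat k + (mu k)^-1 *: (c (x k) - z k))) <= eps k;
  ialm_y : forall k, y k = yhat k + (mu k)^-1 *: (c (x k) - z k);
  ialm_V : forall k, V k = enorm (c (x k) - z k);
  ialm_mu : forall k,
    mu k.+1 = if (k == 0%N) || (V k <= theta * V k.-1) then mu k
              else kappa * mu k }.

End Problem.

(* Main.v *)
Require Import Defs.
From HB Require Import structures.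
From mathcomp Require Import all_boot all_order all_algebra.
From mathcomp Require Import all_classical all_reals all_analysis.
From mathcomp Require Import ring lra.

Import Order.TTheory GRing.Theory Num.Theory.
Import numFieldNormedType.Exports.

Local Open Scope classical_set_scope.
Local Open Scope ring_scope.

(** Write u_k = c(x^k) - z^k, so that V_k = |u_k|. The minimum defining the
    Moreau envelope at c(x^k) + mu_k yhat^k is attained at z^k, and completing
    the square gives
      L(x^k, yhat^k) = f(x^k) + g(z^k) + |u_k|^2 / (2 mu_k) + <yhat^k, u_k>,
    whereas testing the envelope with z = c(x') gives L(x', yhat^k) <= phi(x')
    for feasible x'. Approximate minimality therefore yields the inequality
      f(x^k) + g(z^k) + |u_k|^2 / (2 mu_k) + <yhat^k, u_k> <= phi(x') + eps_k
    ([approx_min_value_bound]), from which everything follows.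

    The coupling term -(|u_k|^2 / (2 mu_k) + <yhat^k, u_k>) is bounded above by
    a null sequence ([coupling_term_bound]). Indeed either mu_k -> 0, and
    Young's inequality bounds it by mu_k |yhat^k|^2 / 2, or the penalty is
    reduced only finitely often, in which case V_k decays geometrically and
    bounds it through |<yhat^k, u_k>| ([penalty_or_residual_cvg0]). Since
    yhat^k stays in the bounded set Y, both bounds vanish, and the limsup
    estimate follows.

    Let now x^k -> xbar along a filter finer than the one at infinity. The
    residual u_k vanishes: this is clear in the second case, and in the first
    case prox-boundedness bounds g(z^k) below by a quadratic in |u_k| with a
    fixed coefficient, which |u_k|^2 / (2 mu_k) eventually beats
    ([residual_cvg0]). Hence z^k -> c(xbar), closedness of dom g makes xbar
    feasible, lower semicontinuity bounds the limit of f(x^k) + g(z^k) below by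
    phi(xbar), and the estimate above with x' = xbar bounds it above
    ([values_along_filter]). Comparison with the other x' is optimality.

    Filters are used in place of index sets so that accumulation points, which
    come with no index set, and the convergence along K are instances of one
    argument. *)

(** * The Euclidean norm and inner product on row vectors *)

Definition dot {R : realType} {m : nat} (u v : 'rV[R]_m) : R :=
  \sum_(i < m) u 0 i * v 0 i.

Lemma enorm_ge0 (R : realType) (m : nat) (v : 'rV[R]_m) : 0 <= enorm v.
Proof. exact: sqrtr_ge0. Qed.

Lemma enorm_sqr (R : realType) (m : nat) (v : 'rV[R]_m) :
  enorm v ^+ 2 = \sum_(i < m) v 0 i ^+ 2.
Proof. by rewrite sqr_sqrtr// sumr_ge0// => i _; exact: sqr_ge0. Qed.

Lemma normr_coord_le (R : realType) (m : nat) (v : 'rV[R]_m) (i : 'I_m) :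
  `|v 0 i| <= `|v|.
Proof.
have -> : `|v| = \big[Num.max/0]_ij `|v ij.1 ij.2| := mx_normrE v.
exact: (le_bigmax _ (fun ij : 'I_1 * 'I_m => `|v ij.1 ij.2|) (ord0, i)).
Qed.

Lemma normr_coord_le_enorm (R : realType) (m : nat) (v : 'rV[R]_m)
  (i : 'I_m) : `|v 0 i| <= enorm v.
Proof.
rewrite -(ler_pXn2r (n := 2)) ?nnegrE ?enorm_ge0// enorm_sqr.
rewrite real_normK ?num_real// (bigD1 i)//= lerDl sumr_ge0// => j _.
exact: sqr_ge0.
Qed.

Lemma normr_le_enorm (R : realType) (m : nat) (v : 'rV[R]_m) :
  `|v| <= enorm v.
Proof.
have -> : `|v| = \big[Num.max/0]_ij `|v ij.1 ij.2| := mx_normrE v.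
apply: bigmax_le; first exact: enorm_ge0.
by move=> [i j] _ /=; rewrite (ord1 i) normr_coord_le_enorm.
Qed.

Lemma enorm_sqr_le (R : realType) (m : nat) (v : 'rV[R]_m) (B : R) :
  `|v| <= B -> enorm v ^+ 2 <= m%:R * B ^+ 2.
Proof.
move=> vB; rewrite enorm_sqr -[m in m%:R](card_ord m) -sum1_card natr_sum.
rewrite mulr_suml ler_sum// => i _; rewrite mul1r -real_normK ?num_real//.
rewrite lerXn2r ?nnegrE// ?(le_trans (normr_coord_le _ _ v i))//.
exact: le_trans vB.
Qed.

Lemma enorm_sqrB_le (R : realType) (m : nat) (u v : 'rV[R]_m) :
  enorm (u - v) ^+ 2 <= 2 * enorm u ^+ 2 + 2 * enorm v ^+ 2.
Proof.
rewrite !enorm_sqr !mulr_sumr -big_split/=; apply: ler_sum => i _.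
rewrite !mxE -subr_ge0.
rewrite (_ : _ - _ = (u 0 i + v 0 i) ^+ 2) ?sqr_ge0//; ring.
Qed.

(** Taking t to be the penalty parameter absorbs the quadratic penalty term
    exactly; taking t = 1 trades the inner product for a fixed quadratic. *)
Lemma oppr_dot_le_young (R : realType) (m : nat) (u v : 'rV[R]_m) (t : R) :
  0 < t ->
  - dot u v <= t / 2 * enorm u ^+ 2 + enorm v ^+ 2 / (2 * t).
Proof.
move=> t0; rewrite !enorm_sqr mulr_sumr mulr_suml -big_split/= -sumrN.
apply: ler_sum => i _; rewrite -subr_ge0.
rewrite (_ : _ - _ = (t * u 0 i + v 0 i) ^+ 2 / (2 * t)).
  by rewrite divr_ge0 ?sqr_ge0// mulr_ge0// ltW.
by field; rewrite gt_eqF.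
Qed.

(** The bound on u is in the sup norm, the norm in which the multipliers are
    bounded; bounding coordinatewise costs the factor m, which does not affect
    convergence to 0 with v. *)
Lemma oppr_dot_le_norm (R : realType) (m : nat) (u v : 'rV[R]_m) (B : R) :
  `|u| <= B ->
  - dot u v <= m%:R * B * enorm v.
Proof.
move=> uB; rewrite -mulrA -[m in m%:R](card_ord m) -sum1_card natr_sum.
rewrite mulr_suml -sumrN ler_sum// => i _; rewrite mul1r.
apply: le_trans (ler_norm _) _; rewrite normrN normrM.
apply: ler_pM => //; last exact: normr_coord_le_enorm.
exact: le_trans (normr_coord_le _ _ _ _) uB.
Qed.

(** * The penalty update *)

Lemma geometric_decay_cvg0 (R : realType) (theta : R) (V : nat -> R) (N : nat) :
  0 < theta < 1 -> (forall k, 0 <= V k) ->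
  (forall k, (N <= k)%N -> V k.+1 <= theta * V k) ->
  V k @[k --> \oo] --> 0.
Proof.
move=> /andP[t0 t1] V0 Vdec; rewrite -(cvg_shiftn N).
apply: (@squeeze_cvgr _ _ _ _ (fun=> 0) (geometric (V N) theta)).
- near=> k; rewrite V0/= /geometric/=; elim: (k) => [|j IH].
    by rewrite add0n expr0 mulr1.
  rewrite addSn (le_trans (Vdec _ (leq_addl _ _)))// exprS mulrCA.
  by rewrite ler_wpM2l// ltW.
- exact: cvg_cst.
- by apply: cvg_geometric; rewrite gtr0_norm.
Unshelve. all: by end_near. Qed.

(** The penalty sequence is nonincreasing and positive, so it has a limit
    L >= 0. If L > 0, then mu k < L / kappa eventually, and a further reduction
    would push the penalty below L; so the test on V succeeds from some index
    on. *)
Lemma penalty_or_residual_cvg0 (R : realType) (theta kappa : R)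
  (mu V : nat -> R) : 0 < theta < 1 -> 0 < kappa < 1 ->
  0 < mu 0%N -> (forall k, 0 <= V k) ->
  (forall k, mu k.+1 = if (k == 0%N) || (V k <= theta * V k.-1) then mu k
              else kappa * mu k) ->
  mu k @[k --> \oo] --> 0 \/ V k @[k --> \oo] --> 0.
Proof.
move=> theta01 /andP[k0 k1] mu0 V0 muS.
have mupos k : 0 < mu k.
  by elim: k => // k IH; rewrite muS; case: ifP => // _; rewrite mulr_gt0.
have mudec : nonincreasing_seq mu.
  apply/nonincreasing_seqP => k; rewrite muS; case: ifP => // _.
  by rewrite ger_pMl ?mupos// ltW.
have cmu : cvgn mu.
  apply: nonincreasing_is_cvgn => //; exists 0 => _ [k _ <-]; exact: ltW.
have L0 : 0 <= limn mu by apply: limr_ge => //; near=> k; exact: ltW.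
have [L_gt0|] := ltP 0 (limn mu); last first.
  move=> L_le0; left; rewrite (_ : 0 = limn mu)//.
  by apply/eqP; rewrite eq_le L0 L_le0.
right.
have [N _ HN] : \forall k \near \oo, mu k < limn mu / kappa.
  by apply: (cvgr_lt (limn mu)) => //; rewrite ltr_pdivlMr// gtr_pMr.
apply: (@geometric_decay_cvg0 _ theta _ N) => // k Nk.
have := muS k.+1; case: ifP => //= _ muk.
have := nonincreasing_cvgn_ge mudec cmu k.+2.
have := HN k.+1 (leqW Nk); rewrite ltr_pdivlMr// mulrC -muk => /= h1 h2.
by have := lt_le_trans h1 h2; rewrite ltxx.
Unshelve. all: by end_near. Qed.

(** * Limits along filters on the indices *)

Lemma limn_esup_le (R : realType) (u : nat -> \bar R) (l : \bar R)
  (r : nat -> R) : r k @[k --> \oo] --> 0 ->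
  (forall k, (u k <= l + (r k)%:E)%E) -> (limn_esup u <= l)%E.
Proof.
move=> r0 ur; apply/lee_addgt0Pr => e e0; rewrite /limn_esup limf_esupE.
apply: (@le_trans _ _ (ereal_sup (u @` [set k | r k <= e]))).
  apply: ereal_inf_lbound; exists [set k | r k <= e] => //.
  exact: (cvgr_le _ r0 _ e0).
apply: ge_ereal_sup => _ [k /= rk <-]; apply: le_trans (ur k) _.
by rewrite leeD2l// lee_fin.
Qed.

Lemma within_infinite_proper (K : set nat) : infinite_set K ->
  ProperFilter (within K \oo).
Proof.
move=> infK; split; last exact: within_filter.
move=> [N _ HN]; apply: infK; apply: sub_finite_set (finite_II N) => k Kk.
by rewrite /= ltnNge; apply/negP => Nk; apply: (HN k).
Qed.

(** The filter generated by the sets of late indices at which u lies in a given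
    neighbourhood of p; these are nonempty because p is a cluster point. *)
Lemma cluster_filter (T : topologicalType) (u : nat -> T) (p : T) :
  cluster (u k @[k --> \oo]) p ->
  exists2 F : set_system nat, ProperFilter F &
    F --> \oo /\ u k @[k --> F] --> p.
Proof.
move=> clp.
pose B (NA : nat * set T) := [set k | (NA.1 <= k)%N /\ NA.2 (u k)].
exists (filter_from [set NA | nbhs p NA.2] B).
  apply: filter_from_proper; last first.
    move=> [N A] /= pA.
    have [|_ [[k Nk <-] Auk]] := clp (u @` [set k | (N <= k)%N]) A _ pA.
      by exists N => // k Nk /=; exists k.
    by exists k.
  apply: filter_from_filter; first by exists (0%N, setT); exact: filterT.
  move=> [N A] [M C] /= pA pC; exists (maxn N M, A `&` C) => /=.
    exact: filterI.
  by move=> k [/=]; rewrite geq_max => /andP[? ?] [? ?].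
split.
  move=> S [N _ NS]; exists (N, setT); first exact: filterT.
  by move=> k [Nk _]; exact: NS.
by move=> S pS; exists (0%N, S) => // k [].
Qed.

Lemma cvg_finer (T : topologicalType) (F G : set_system nat) (u : nat -> T)
  (l : T) : F --> G -> u k @[k --> G] --> l -> u k @[k --> F] --> l.
Proof. by move=> FG ul A /ul; exact: FG. Qed.

(** * The augmented Lagrangian *)

Lemma prox_fin_num (R : realType) (m : nat) (g : 'rV[R]_m -> \bar R)
  (mu : R) (w z : 'rV[R]_m) : proper_ext g -> prox g mu w z ->
  g z \is a fin_num.
Proof.
move=> [gNy [z0 z0dom]] pz; rewrite fin_numElt ltNye gNy/=.
have := pz z0; rewrite /prox_obj => le0.
have : (g z + (enorm (z - w) ^+ 2 / (2 * mu))%:E < +oo)%E.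
  by apply: le_lt_trans le0 _; rewrite lte_add_pinfty// ltry.
by case: (g z) => [r||]; rewrite ?ltry.
Qed.

(** The reason why the augmented Lagrangian subtracts mu / 2 |y|^2: what remains
    of the shifted quadratic is the penalty plus a term linear in the
    residual. *)
Lemma complete_square (R : realType) (m : nat) (mu : R) (a y z : 'rV[R]_m) :
  mu != 0 ->
  enorm (z - (a + mu *: y)) ^+ 2 / (2 * mu) - mu / 2 * enorm y ^+ 2 =
  enorm (a - z) ^+ 2 / (2 * mu) + dot y (a - z).
Proof.
move=> mu0; rewrite !enorm_sqr !mulr_suml mulr_sumr -sumrB -big_split/=.
by apply: eq_bigr => i _; rewrite !mxE; field.
Qed.

Lemma moreau_env_prox (R : realType) (m : nat) (g : 'rV[R]_m -> \bar R)
  (mu : R) (w z : 'rV[R]_m) : prox g mu w z ->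
  moreau_env g mu w = prox_obj g mu w z.
Proof.
move=> pz; apply/le_anti/andP; split.
  by apply: ereal_inf_lbound; exists z.
by apply: le_ereal_inf_tmp => _ [z' _ <-]; exact: pz.
Qed.

Lemma aug_lagrangian_prox (R : realType) (n m : nat) (f : 'rV[R]_n -> R)
  (c : 'rV[R]_n -> 'rV[R]_m) (g : 'rV[R]_m -> \bar R) (mu : R)
  (x : 'rV[R]_n) (y z : 'rV[R]_m) :
  proper_ext g -> 0 < mu -> prox g mu (c x + mu *: y) z ->
  aug_lagrangian f c g mu x y =
  (f x + fine (g z)
   + (enorm (c x - z) ^+ 2 / (2 * mu) + dot y (c x - z)))%:E.
Proof.
move=> gP mu0 pz; rewrite /aug_lagrangian (moreau_env_prox _ _ _ _ _ _ pz).
rewrite /prox_obj -(fineK (prox_fin_num _ _ _ _ _ _ gP pz)) -!EFinD.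
by rewrite -complete_square ?gt_eqF// !addrA.
Qed.

(** The envelope is tested with z = c x, for which the residual, hence the whole
    penalty, is zero. *)
Lemma aug_lagrangian_feasible (R : realType) (n m : nat) (f : 'rV[R]_n -> R)
  (c : 'rV[R]_n -> 'rV[R]_m) (g : 'rV[R]_m -> \bar R) (mu : R)
  (x : 'rV[R]_n) (y : 'rV[R]_m) :
  g (c x) \is a fin_num -> 0 < mu ->
  (aug_lagrangian f c g mu x y <= objective f c g x)%E.
Proof.
move=> gfin mu0.
have : (moreau_env g mu (c x + mu *: y)
        <= prox_obj g mu (c x + mu *: y) (c x))%E.
  by apply: ereal_inf_lbound; exists (c x).
rewrite /aug_lagrangian /prox_obj /objective leeBlDr// -(fineK gfin) => h.
rewrite -addeA leeD2l//; apply: le_trans h _.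
rewrite -!EFinD lee_fin lerD2l -subr_le0 complete_square ?gt_eqF// subrr.
rewrite enorm_sqr /dot !big1 ?mul0r ?addr0// => i _; rewrite mxE ?mulr0//.
by rewrite expr0n.
Qed.

(** When mu -> 0 the square of u is kept, to be absorbed by Young's inequality
    with parameter mu; when u -> 0 it is dropped. *)
Lemma coupling_term_bound (R : realType) (m : nat) (mu : nat -> R)
  (y u : nat -> 'rV[R]_m) (B : R) :
  (forall k, 0 < mu k) -> (forall k, `|y k| <= B) ->
  mu k @[k --> \oo] --> 0 \/ enorm (u k) @[k --> \oo] --> 0 ->
  exists2 r : nat -> R, r k @[k --> \oo] --> 0 &
    forall k, - (enorm (u k) ^+ 2 / (2 * mu k) + dot (y k) (u k)) <= r k.
Proof.
move=> mu0 yB [mu_to0|u_to0].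
  exists (fun k => mu k * (2^-1 * (m%:R * B ^+ 2))).
    rewrite -[X in _ --> X](mul0r (2^-1 * (m%:R * B ^+ 2))).
    exact: cvgMr_tmp.
  move=> k; rewrite opprD addrC lerBlDr.
  apply: le_trans (oppr_dot_le_young _ _ _ _ _ (mu0 k)) _.
  by rewrite lerD2r -mulrA !ler_wpM2l ?(ltW (mu0 k))// enorm_sqr_le.
exists (fun k => m%:R * B * enorm (u k)).
  by rewrite -[X in _ --> X](mulr0 (m%:R * B)); apply: cvgMl_tmp.
move=> k; apply: le_trans (oppr_dot_le_norm _ _ _ (u k) _ (yB k)).
by rewrite lerN2 lerDr divr_ge0 ?sqr_ge0// mulr_ge0// ltW.
Qed.

(** Once 4 A2 mu_k <= 1, the right-hand quadratic is absorbed by half of the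
    left-hand side, leaving V_k^2 <= 4 mu_k A1. *)
Lemma residual_cvg0_of_growth (R : realType) (F : set_system nat)
  (FF : ProperFilter F) (mu V : nat -> R) (A1 A2 : R) :
  (forall k, 0 < mu k) -> mu k @[k --> F] --> 0 -> (forall k, 0 <= V k) ->
  0 < A2 ->
  (\forall k \near F, V k ^+ 2 / (2 * mu k) <= A1 + A2 * V k ^+ 2) ->
  V k @[k --> F] --> 0.
Proof.
move=> mu_gt0 mu_to0 V0 A2_gt0 growth.
have sqV : (V k ^+ 2) @[k --> F] --> 0.
  apply: (@squeeze_cvgr _ _ _ _ (fun=> 0) (fun k => mu k * (4 * A1))).
  - near=> k; rewrite sqr_ge0/=.
    have muA2 : mu k <= (4 * A2)^-1.
      by near: k; apply: (cvgr_le _ mu_to0); rewrite invr_gt0 mulr_gt0.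
    have : V k ^+ 2 / (2 * mu k) <= A1 + A2 * V k ^+ 2 by near: k.
    rewrite ler_pdivrMr ?mulr_gt0// => h.
    have : A2 * mu k * V k ^+ 2 <= 4^-1 * V k ^+ 2.
      rewrite ler_wpM2r ?sqr_ge0// mulrC -ler_pdivlMr//.
      by rewrite -invfM.
    by lra.
  - exact: cvg_cst.
  - by rewrite -[X in _ --> X](mul0r (4 * A1)); apply: cvgMr_tmp.
have -> : V = (fun k => Num.sqrt (V k ^+ 2)).
  by apply/funext => k; rewrite sqrtr_sqr ger0_norm.
rewrite -[X in _ --> X]sqrtr0.
by apply: (cvg_comp _ _ sqV); exact: sqrt_continuous.
Unshelve. all: by end_near. Qed.

(** * Asymptotics of the iterates *)

Lemma approx_min_value_bound (R : realType) (n m : nat) (f : 'rV[R]_n -> R)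
  (c : 'rV[R]_n -> 'rV[R]_m) (g : 'rV[R]_m -> \bar R) (mu e : R)
  (x x' : 'rV[R]_n) (y z : 'rV[R]_m) :
  proper_ext g -> 0 < mu -> prox g mu (c x + mu *: y) z ->
  (aug_lagrangian f c g mu x y <= aug_lagrangian f c g mu x' y + e%:E)%E ->
  g (c x') \is a fin_num ->
  f x + fine (g z) + (enorm (c x - z) ^+ 2 / (2 * mu) + dot y (c x - z))
  <= f x' + fine (g (c x')) + e.
Proof.
move=> gP mu0 pz xmin gfin; rewrite -lee_fin.
rewrite -(aug_lagrangian_prox _ _ _ f c g _ _ _ _ gP mu0 pz).
apply: le_trans xmin _; rewrite EFinD leeD2r//.
apply: le_trans (aug_lagrangian_feasible _ _ _ f c g mu x' y gfin mu0) _.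
by rewrite /objective -[g (c x')]fineK.
Qed.

(** The value bound has the penalty |u|^2 / (2 mu) on its left-hand side. All
    other terms are at least a constant minus a fixed multiple of |u|^2: f(x^k)
    and c(x^k) are bounded since x^k converges, the inner product by Young's
    inequality, and g(z^k) by prox-boundedness with
    |z|^2 <= 2 |c(x)|^2 + 2 |u|^2. Hence u -> 0 as mu -> 0. *)
Lemma residual_cvg0 (R : realType) (n m : nat) (f : 'rV[R]_n -> R)
  (c : 'rV[R]_n -> 'rV[R]_m) (g : 'rV[R]_m -> \bar R)
  (F : set_system nat) (FF : ProperFilter F) (mu : nat -> R)
  (x : nat -> 'rV[R]_n) (y z : nat -> 'rV[R]_m) (xbar : 'rV[R]_n)
  (B p : R) :
  continuous f -> continuous c -> prox_bounded g ->
  (forall k, g (z k) \is a fin_num) ->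
  (forall k, 0 < mu k) -> mu k @[k --> F] --> 0 ->
  (forall k, `|y k| <= B) -> x k @[k --> F] --> xbar ->
  (\forall k \near F, f (x k) + fine (g (z k))
    + (enorm (c (x k) - z k) ^+ 2 / (2 * mu k) + dot (y k) (c (x k) - z k))
    <= p) ->
  enorm (c (x k) - z k) @[k --> F] --> 0.
Proof.
move=> cf cc [nu [nu0 [b gb]]] gfin mu0 mu_to0 yB x_to bound.
have fx_to : f (x k) @[k --> F] --> f xbar.
  exact: (cvg_comp _ _ x_to (cf xbar)).
have cx_to : c (x k) @[k --> F] --> c xbar.
  exact: (cvg_comp _ _ x_to (cc xbar)).
pose C := m%:R * (`|c xbar| + 1) ^+ 2; pose D := m%:R * B ^+ 2.
pose A1 := p - (f xbar - 1) - b + C / nu + D / 2.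
pose A2 := nu^-1 + 2^-1.
apply: (@residual_cvg0_of_growth _ _ _ mu _ A1 A2) => //.
- by move=> k; exact: enorm_ge0.
- by rewrite addr_gt0 ?invr_gt0.
near=> k.
have hb : f (x k) + fine (g (z k))
    + (enorm (c (x k) - z k) ^+ 2 / (2 * mu k) + dot (y k) (c (x k) - z k))
    <= p by near: k.
have hf : f xbar - 1 <= f (x k).
  by near: k; apply: (cvgr_ge _ fx_to); rewrite gtrBl.
have hc : enorm (c (x k)) ^+ 2 <= C.
  apply: enorm_sqr_le; near: k; apply: (cvgr_norm_le _ cx_to).
  by rewrite ltrDl.
have hg : b - enorm (z k) ^+ 2 / (2 * nu) <= fine (g (z k)).
  rewrite lerBlDr -lee_fin EFinD fineK//; exact: gb.
have hz : enorm (z k) ^+ 2 / (2 * nu)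
          <= nu^-1 * (C + enorm (c (x k) - z k) ^+ 2).
  rewrite ler_pdivrMr ?mulr_gt0//.
  have -> : nu^-1 * (C + enorm (c (x k) - z k) ^+ 2) * (2 * nu)
      = 2 * C + 2 * enorm (c (x k) - z k) ^+ 2 by field; rewrite gt_eqF.
  have := enorm_sqrB_le _ _ (c (x k)) (c (x k) - z k).
  by rewrite subKr => h; apply: le_trans h _; rewrite lerD2r ler_wpM2l.
have hd := oppr_dot_le_young _ _ (y k) (c (x k) - z k) 1 ltr01.
have hy := enorm_sqr_le _ _ _ _ (yB k).
rewrite -/D in hy; rewrite /A1 /A2.
(* The conclusion is linear in these quantities and in nu^-1 times the squares
   of the norms. *)
move: hb hf hg hz hd hy.
move: (_ / (2 * mu k)) (_ / (2 * nu)) (nu^-1) (enorm (y k) ^+ 2).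
move: (enorm (c (x k) - z k) ^+ 2) (dot _ _) (f (x k)) (fine _) => v d fk gk.
by move=> q w i Y *; lra.
Unshelve. all: by end_near. Qed.

Lemma lsc_near_fine (R : realType) (m : nat) (g : 'rV[R]_m -> \bar R)
  (F : set_system nat) (FF : Filter F) (z : nat -> 'rV[R]_m) (p : 'rV[R]_m)
  (e : R) : lower_semicontinuous g -> (forall k, g (z k) \is a fin_num) ->
  g p \is a fin_num -> z k @[k --> F] --> p -> 0 < e ->
  \forall k \near F, fine (g p) - e < fine (g (z k)).
Proof.
move=> glsc gfin gp z_to e0.
have [|W pW Wg] := glsc p (fine (g p) - e).
  by rewrite -[ltRHS](fineK gp) lte_fin gtrBl.
apply: (@filterS _ _ FF _ _ _ (z_to W pW)) => k /= Wz.
by rewrite -lte_fin fineK//; exact: Wg.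
Qed.

(** Closedness of the domain makes xbar feasible, so the value bound applies
    with x' = xbar; this upper bound and lower semicontinuity squeeze the
    values. *)
Lemma values_along_filter (R : realType) (n m : nat) (f : 'rV[R]_n -> R)
  (c : 'rV[R]_n -> 'rV[R]_m) (g : 'rV[R]_m -> \bar R)
  (F : set_system nat) (FF : ProperFilter F)
  (x : nat -> 'rV[R]_n) (z : nat -> 'rV[R]_m) (xbar : 'rV[R]_n)
  (r : nat -> R) :
  continuous f -> continuous c -> proper_ext g -> lower_semicontinuous g ->
  closed (dom g) ->
  (forall k, g (z k) \is a fin_num) ->
  x k @[k --> F] --> xbar -> enorm (c (x k) - z k) @[k --> F] --> 0 ->
  r k @[k --> F] --> 0 ->
  (forall x', g (c x') \is a fin_num -> forall k,
    f (x k) + fine (g (z k)) <= f x' + fine (g (c x')) + r k) ->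
  [/\ z k @[k --> F] --> c xbar, g (c xbar) \is a fin_num &
      f (x k) + fine (g (z k)) @[k --> F] --> f xbar + fine (g (c xbar))].
Proof.
move=> cf cc gP glsc domcl gfin x_to V_to r_to bound.
have fx_to : f (x k) @[k --> F] --> f xbar.
  exact: (cvg_comp _ _ x_to (cf xbar)).
have cx_to : c (x k) @[k --> F] --> c xbar.
  exact: (cvg_comp _ _ x_to (cc xbar)).
have z_to : z k @[k --> F] --> c xbar.
  have u_to : c (x k) - z k @[k --> F] --> (0 : 'rV[R]_m).
    apply/cvgr0Pnorm_le => e e0; near=> k.
    apply: le_trans (normr_le_enorm _ _ _) _.
    by near: k; apply: (cvgr_le _ V_to).
  have -> : z = (fun k => c (x k) - (c (x k) - z k)).
    by apply/funext => k; rewrite subKr.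
  by rewrite -[X in _ --> X]subr0; apply: cvgB.
have gc : g (c xbar) \is a fin_num.
  rewrite fin_numElt ltNye gP.1/=.
  apply: (closed_cvg (dom g) domcl _ _ z_to); near=> k.
  by have := gfin k; rewrite fin_numElt => /andP[].
split => //; apply/cvgrPdist_le => e e0.
have e20 : 0 < e / 2 by rewrite divr_gt0.
near=> k.
have h1 : f xbar - e / 2 <= f (x k).
  by near: k; apply: (cvgr_ge _ fx_to); rewrite gtrBl.
have h2 : fine (g (c xbar)) - e / 2 < fine (g (z k)).
  by near: k; exact: lsc_near_fine.
have h3 : r k <= e by near: k; apply: (cvgr_le _ r_to).
have h4 := bound xbar gc k.
by rewrite ler_norml; apply/andP; split; lra.
Unshelve. all: by end_near. Qed.

(** * Global optimality of accumulation points *)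

Theorem theorem4p3 (R : realType) (n m : nat)
  (f : 'rV[R]_n -> R) (c : 'rV[R]_n -> 'rV[R]_m) (g : 'rV[R]_m -> \bar R)
  (f_C2 : C2 f) (c_C2 : C2 c)
  (g_proper : proper_ext g) (g_lsc : lower_semicontinuous g)
  (g_prox_bounded : prox_bounded g)
  (inf_phi : ereal_inf (range (objective f c g)) \is a fin_num)
  (mu0 theta kappa : R) (Y : set 'rV[R]_m)
  (mu0_gt0 : 0 < mu0) (mu0_lt : (mu0%:E < prox_threshold g)%E)
  (theta01 : 0 < theta < 1) (kappa01 : 0 < kappa < 1)
  (Y_nonempty : Y !=set0) (Y_bounded : bounded_set Y)
  (eps mu : nat -> R) (yhat : nat -> 'rV[R]_m)
  (x : nat -> 'rV[R]_n) (z y : nat -> 'rV[R]_m) (V : nat -> R)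
  (alg : ialm_sequence f c g mu0 theta kappa Y eps mu yhat x z y V)
  (eps_to0 : eps k @[k --> \oo] --> (0 : R))
  (x_min : forall k (x' : 'rV[R]_n),
    (aug_lagrangian f c g (mu k) (x k) (yhat k)
     <= aug_lagrangian f c g (mu k) x' (yhat k) + (eps k)%:E)%E)
  (feas_nonempty : exists x' : 'rV[R]_n, feasible c g x')
  (dom_closed : closed (dom g)) :
  (forall x' : 'rV[R]_n, feasible c g x' ->
     (limn_esup (fun k => (f (x k))%:E + g (z k)) <= objective f c g x')%E) /\
  (forall xbar : 'rV[R]_n, cluster (x k @[k --> \oo]) xbar ->
     globally_optimal f c g xbar /\
     forall K : set nat, infinite_set K ->
       x k @[k --> within K \oo] --> xbar ->
       z k @[k --> within K \oo] --> c xbar /\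
       ((f (x k))%:E + g (z k))%E @[k --> within K \oo]
         --> objective f c g xbar).
Proof.
have cf : continuous f.
  by move=> u; apply: differentiable_continuous; exact: f_C2.1.
have cc : continuous c.
  by move=> u; apply: differentiable_continuous; exact: c_C2.1.
have [mu_0 yhatY eps_ge0 z_prox _ _ VE muS] := alg.
have mu_gt0 k : 0 < mu k.
  elim: k => [|k IH]; first by rewrite mu_0.
  by rewrite muS; case: ifP => // _; rewrite mulr_gt0//; case/andP: kappa01.
have gfin k : g (z k) \is a fin_num by exact: prox_fin_num (z_prox k).
have [B yB] : exists B, forall k, `|yhat k| <= B.
  have [M [_ HM]] := Y_bounded; exists (M + 1) => k.
  by apply: HM; rewrite ?ltrDl.
have dich : mu k @[k --> \oo] --> 0
            \/ enorm (c (x k) - z k) @[k --> \oo] --> 0.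
  have -> : (fun k => enorm (c (x k) - z k)) = V.
    by apply/funext => k; rewrite VE.
  apply: (penalty_or_residual_cvg0 _ theta kappa) => //.
  by move=> k; rewrite VE enorm_ge0.
have [s s_to sP] := coupling_term_bound _ _ mu yhat _ B mu_gt0 yB dich.
have step x' (gx' : g (c x') \is a fin_num) k :=
  approx_min_value_bound _ _ _ f c g _ _ _ x' _ _ g_proper (mu_gt0 k)
    (z_prox k) (x_min k x') gx'.
pose r k := eps k + s k.
have r_to : r k @[k --> \oo] --> 0.
  by rewrite -[X in _ --> X](addr0 0); exact: cvgD.
have bound x' (gx' : g (c x') \is a fin_num) k :
    f (x k) + fine (g (z k)) <= f x' + fine (g (c x')) + r k.
  by have := step x' gx' k; have := sP k; rewrite /r; lra.
have feasible_fin x' : feasible c g x' -> g (c x') \is a fin_num.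
  by move=> fx'; rewrite fin_numElt ltNye g_proper.1.
have objE x' : g (c x') \is a fin_num ->
    objective f c g x' = (f x' + fine (g (c x')))%:E.
  by move=> gx'; rewrite /objective -[g (c x')]fineK.
have along (F : set_system nat) (FF : ProperFilter F) xbar :
    F --> \oo -> x k @[k --> F] --> xbar ->
    [/\ z k @[k --> F] --> c xbar, g (c xbar) \is a fin_num &
        f (x k) + fine (g (z k)) @[k --> F] --> f xbar + fine (g (c xbar))].
  move=> Foo x_to; apply: (@values_along_filter _ _ _ _ _ _ _ _ _ _ _ r) => //.
    case: dich => [mu_to0|V_to0]; last exact: (cvg_finer _ _ _ _ _ Foo) V_to0.
    (* Any feasible point bounds the values; 1 dominates eps k eventually. *)
    have [x0 /feasible_fin gx0] := feas_nonempty.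
    apply: (residual_cvg0 _ _ _ f c g _ _ mu x yhat z xbar B
      (f x0 + fine (g (c x0)) + 1)) => //.
      exact: (cvg_finer _ _ _ _ _ Foo) mu_to0.
    near=> k; apply: le_trans (step x0 gx0 k) _; rewrite lerD2l.
    near: k; apply: Foo; exact: (cvgr_le _ eps_to0).
  exact: (cvg_finer _ _ _ _ _ Foo) r_to.
split=> [x' /feasible_fin gx'|xbar clx].
  apply: (limn_esup_le _ _ _ r) => // k.
  by rewrite objE// -[g (z k)]fineK// -!EFinD lee_fin bound.
split.
  have [F FF [Foo x_to]] := cluster_filter _ _ _ clx.
  have [_ gxbar val_to] := along F FF xbar Foo x_to.
  split; first by move: gxbar; rewrite fin_numElt => /andP[].
  move=> x'; have [/feasible_fin gx'|] := pselect (feasible c g x').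
    rewrite !objE// lee_fin.
    have r_toF : f x' + fine (g (c x')) + r k @[k --> F]
        --> f x' + fine (g (c x')).
      rewrite -[X in _ --> X]addr0; apply: cvgD; first exact: cvg_cst.
      exact: (cvg_finer _ _ _ _ _ Foo) r_to.
    apply: (ler_cvg_to val_to r_toF); near=> k; exact: bound.
  move=> /negP; rewrite /feasible /dom /= -leNgt leye_eq => /eqP.
  by rewrite /objective => ->; rewrite addey// leey.
move=> K infK x_to.
have KF := within_infinite_proper K infK.
have [z_to gxbar val_to] := along _ KF xbar (cvg_within _) x_to.
split=> //; rewrite objE//; apply: cvg_EFin.
  by near=> k; rewrite fin_numD gfin.
apply: cvg_trans val_to; apply: near_eq_cvg; near=> k.
by rewrite /= -{2}[g (z k)]fineK.
Unshelve. all: by end_near. Qed.
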